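(* Consider the two-player pricing game with action sets $[0,\phi_h]$ and payoffs $\mathcal M_i(\phi_1,\phi_2;0)$, $i\in\{1,2\}$ (the regime $\beta=0$). Define $$d_b(\phi):=f(\phi)+2\phi f'(\phi),\qquad \phi_b:=\max\{\phi\in[0,\phi_h]: d_b(\phi)\ge 0\}.$$ (1) If $\rho\le f(\phi_b)/2$, then $(f^{-1}(2\rho),f^{-1}(2\rho))$ is the unique symmetric Nash equilibrium. (2) If $f(\phi_b)/2<\rho<1$, then there does not exist a symmetric pure strategy Nash equilibrium. However, there exists a symmetric mixed strategy Nash equilibrium $(\sigma^*,\sigma^* )$, supported over $[\phi_L^*,\phi_R^*]$, where $\phi_L^*$ and $\phi_R^*$ are respectively the maximum value and the maximizer over $[0,\phi_h]$ of the function $\phi\mapsto (f(\phi)-\rho)\phi/\rho$, and $$\sigma^*([\phi_L^*,\phi])=\frac{e(\phi+\phi_R^* )-\Lambda f(\phi_R^* )\phi_R^*}{2e\phi-\Lambda f(\phi)\phi}\qquad\text{for }\phi\in[\phi_L^*,\phi_R^*].$$ (3) If $\rho\ge 1$, then for any $\epsilon>0$, choosing $0<\delta\le\phi_h$ such that $\sup_{\phi\le\delta}\Lambda f(\phi)\phi<\epsilon$, the profile $(\delta,\delta)$ is an $\epsilon$-Nash equilibrium.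
   Context: Fix $\phi_h>0$ and $f:[0,\phi_h]\to\mathbb R$ strictly concave, strictly decreasing and differentiable, with $0<f(\phi)\le 1$ for all $\phi$ and $f(0)=1$. Fix $\Lambda>0$, $e>0$, and let $\rho:=e/\Lambda$. The extended inverse $f^{-1}:[0,\infty)\to[0,\phi_h]$ is: $f^{-1}(x)=\phi_h$ for $0\le x<f(\phi_h)$; $f^{-1}(x)$ is the unique $\phi$ with $f(\phi)=x$ for $f(\phi_h)\le x\le 1$; $f^{-1}(x)=0$ for $x>1$. Payoffs: let $m(\phi):=(\Lambda f(\phi)-e)\phi$. If $\phi_1>\phi_2$: - if $f(\phi_1)>2\rho$: $\mathcal M_1=e\phi_1$, $\mathcal M_2=e\phi_2$; - if $\rho<f(\phi_1)\le 2\rho$: $\mathcal M_1=m(\phi_1)$, $\mathcal M_2=e\phi_2$; - if $f(\phi_1)\le\rho$: $\mathcal M_1=0$, $\mathcal M_2=\min\{e,\Lambda f(\phi_2)\}\phi_2$. If $\phi_1=\phi_2$: $\mathcal M_i=e\phi_i$ if $f(\phi_i)>2\rho$, and $\mathcal M_i=\frac{\Lambda}{2}f(\phi_i)\phi_i$ otherwise, $i=1,2$. If $\phi_1<\phi_2$, the roles of the two platforms are interchanged. Here $\mathcal M_i=\mathcal M_i(\phi_1,\phi_2;0)$. ''Nash equilibrium'' without qualification means in pure strategies (price profiles in $[0,\phi_h]^2$). A mixed strategy is a Borel probability measure on $[0,\phi_h]$, payoffs being extended by expectation under independent play; a mixed NE is one against which no unilateral deviation is profitable. A profile $\sigma$ is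 an $\epsilon$-Nash equilibrium if $\mathcal M_i(\phi_i,\sigma_{-i})\le\mathcal M_i(\sigma_i,\sigma_{-i})+\epsilon$ for every $i$ and every $\phi_i\in[0,\phi_h]$. *)

(* Defs.v *)
From mathcomp Require Import all_boot all_order all_algebra.
From mathcomp Require Import all_classical all_reals all_analysis.
Import Order.TTheory GRing.Theory Num.Theory numFieldNormedType.Exports.

Set Implicit Arguments.
Unset Strict Implicit.
Unset Printing Implicit Defensive.

Local Open Scope classical_set_scope.
Local Open Scope ring_scope.

Section RealFunctions.
Context {R : realType}.
Implicit Types (f : R -> R) (A : set R).

Definition strictly_concave_on A f :=
  forall x y t, A x -> A y -> x != y -> 0 < t -> t < 1 ->
    t * f x + (1 - t) * f y < f (t * x + (1 - t) * y).

Definition strictly_decreasing_on A f :=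
  forall x y, A x -> A y -> x < y -> f y < f x.

(* Differentiation of f as a function on A: only points of A enter the limit,
   so that it is one-sided at the endpoints of a segment, and the values of f
   outside A are irrelevant. *)
Definition quotient_at A f (x : R) :=
  (f y - f x) / (y - x) @[y --> within A x^'].

Definition differentiable_on A f := forall x, A x -> cvg (quotient_at A f x).

Definition deriv_on A f (x : R) : R := lim (quotient_at A f x).

Definition is_max_of A (x : R) := A x /\ ubound A x.

Definition is_maximizer A f (x : R) := A x /\ forall y, A y -> f y <= f x.

End RealFunctions.

Section Games.
Context {R : realType}.
Implicit Types (D : set R) (u : R -> R -> R).
Implicit Types s : probability (measurableTypeR R) R.

(* Two-player games with common action set D; u1 x1 x2 and u2 x1 x2 are the
   payoffs of players 1 and 2 at the profile (x1, x2). *)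
Definition eps_nash D u1 u2 (eps x1 x2 : R) :=
  [/\ D x1, D x2,
      forall y, D y -> u1 y x2 <= u1 x1 x2 + eps &
      forall y, D y -> u2 x1 y <= u2 x1 x2 + eps].

Definition pure_nash D u1 u2 (x1 x2 : R) :=
  [/\ D x1, D x2,
      forall y, D y -> u1 y x2 <= u1 x1 x2 &
      forall y, D y -> u2 x1 y <= u2 x1 x2].

(* Borel probability measures on D are represented by those on the real line
   that give D mass 1. *)
Definition mixed_strategy D s := s D = 1%E.

Definition expected_payoff D u s1 s2 : \bar R :=
  (\int[s1 \x s2]_(p in D `*` D) (u p.1 p.2)%:E)%E.

Definition mixed_nash D u1 u2 s1 s2 :=
  [/\ mixed_strategy D s1, mixed_strategy D s2,
      forall t, mixed_strategy D t ->
        (expected_payoff D u1 t s2 <= expected_payoff D u1 s1 s2)%E &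
      forall t, mixed_strategy D t ->
        (expected_payoff D u2 s1 t <= expected_payoff D u2 s1 s2)%E].

Definition supported_over s (A : set R) :=
  [/\ closed A, s A = 1%E &
      forall U : set R, open U -> U `&` A !=set0 -> (0 < s U)%E].

End Games.

Section Pricing.
Context {R : realType}.
Variables (phi_h : R) (f : R -> R) (Lam e : R).

Definition prices : set R := `[0, phi_h].

Definition rho : R := e / Lam.

(* The extended inverse of f on the nonnegative reals. *)
Definition f_inv (x : R) : R :=
  if x < f phi_h then phi_h
  else if x <= 1 then xget 0 [set phi | prices phi /\ f phi = x]
  else 0.

Definition m (phi : R) : R := (Lam * f phi - e) * phi.

Definition payoff_high (hi : R) : R :=
  if 2 * rho < f hi then e * hi
  else if rho < f hi then m hi
  else 0.

Definition payoff_low (hi lo : R) : R :=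
  if 2 * rho < f hi then e * lo
  else if rho < f hi then e * lo
  else Num.min e (Lam * f lo) * lo.

Definition payoff_tie (phi : R) : R :=
  if 2 * rho < f phi then e * phi else Lam / 2 * f phi * phi.

Definition M1 (phi1 phi2 : R) : R :=
  if phi2 < phi1 then payoff_high phi1
  else if phi1 == phi2 then payoff_tie phi1
  else payoff_low phi2 phi1.

Definition M2 (phi1 phi2 : R) : R :=
  if phi2 < phi1 then payoff_low phi1 phi2
  else if phi1 == phi2 then payoff_tie phi2
  else payoff_high phi2.

Definition d_b (phi : R) : R := f phi + 2 * phi * deriv_on prices f phi.

End Pricing.

(* Main.v *)
From HB Require Import structures.
Require Import Defs.
From mathcomp Require Import all_boot all_order all_algebra.
From mathcomp Require Import all_classical all_reals all_analysis.
From mathcomp Require Import measurable_realfun ring lra.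
Import Order.TTheory GRing.Theory Num.Theory numFieldNormedType.Exports.

(* Put h(x) = (f(x) - rho) x, so that Lam h is the payoff m; f being decreasing
   and strictly concave, h is strictly concave.  At a price x with f(x) = 2 rho
   one has h'(x) = d_b(x) / 2, and d_b is strictly decreasing.  Hence at the
   candidate f^{-1}(2 rho) raising the price pays off exactly when the candidate
   lies below phi_b.  A common price x with f(x) > 2 rho is beaten by a slightly
   larger one, and one with f(x) < 2 rho by a slightly smaller one.

   In the mixed regime let q maximize h, g = h / rho and L = g(q).  The same
   derivative gives f(q) < 2 rho, whence L < q and g(x) < x on [L, q].  Against
   an opponent with an atomless distribution function G carried by [L, q], the
   price x in [L, q] earns e x - G(x) (e x - m(x)) = e (x - G(x) (x - g(x))),
   which is the constant e L iff G(x) = (x - L) / (x - g(x)).  This G increases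
   from 0 to 1 because g increases to g(q) = L; prices x < L earn e x < e L, and
   prices above q earn at most m(q) = e L. *)

Set Implicit Arguments.
Unset Strict Implicit.
Unset Printing Implicit Defensive.

Local Open Scope classical_set_scope.
Local Open Scope ring_scope.

(** * Projection of the line onto a segment *)

Section Clamp.
Context {R : realType}.
Variables a c : R.
Hypothesis ac : a <= c.

Definition clamp (x : R) : R := Num.max a (Num.min x c).

Lemma clamp_itv x : a <= clamp x /\ clamp x <= c.
Proof. by rewrite /clamp le_max lexx ge_max ac ge_min lexx orbT. Qed.

Lemma clamp_id x : a <= x -> x <= c -> clamp x = x.
Proof. by move=> ax xc; rewrite /clamp (min_idPl xc); exact/max_idPr. Qed.

Lemma clamp_le x : x <= a -> clamp x = a.
Proof. by move=> xa; apply/max_idPl; rewrite ge_min xa. Qed.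

Lemma clamp_ge x : c <= x -> clamp x = c.
Proof. by move=> cx; rewrite /clamp (min_idPr cx); exact/max_idPr. Qed.

Lemma clamp_nd : nondecreasing clamp.
Proof.
move=> x y xy; rewrite /clamp ge_max le_max lexx /= le_max; apply/orP; right.
by rewrite le_min !ge_min lexx xy /= orbT.
Qed.

Lemma clamp_lipschitz x y : `|clamp x - clamp y| <= `|x - y|.
Proof.
wlog xy : x y / x <= y => [wl|].
  have [/wl//|/ltW/wl] := leP x y.
  by rewrite distrC (distrC y).
have := clamp_nd xy; rewrite distrC (distrC x) -subr_ge0 => /ger0_norm ->.
rewrite ger0_norm ?subr_ge0//.
have [cy|yc] := leP c y.
  have [cx|/ltW xc] := leP c x; first by rewrite !clamp_ge// subrr subr_ge0.
  rewrite (clamp_ge cy); have : x <= clamp x.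
    by have [ax|/ltW xa] := leP a x; [rewrite clamp_id|rewrite clamp_le].
  lra.
have [xa|/ltW ax] := leP x a; last first.
  have ay := le_trans ax xy; have xc := le_trans xy (ltW yc).
  by rewrite !clamp_id// ltW.
rewrite (clamp_le xa); have [ya|/ltW ay] := leP y a.
  by rewrite (clamp_le ya) subrr subr_ge0.
by rewrite (clamp_id ay (ltW yc)) lerB.
Qed.

Lemma clamp_continuous : continuous clamp.
Proof.
move=> x; apply/cvgrPdist_lt => eps eps0; near=> y.
apply: (le_lt_trans (clamp_lipschitz _ _)).
by near: y; exact: cvgr_dist_lt.
Unshelve. all: by end_near. Qed.

End Clamp.

(** * Tangents of a decreasing concave function and the sign of [d_b] *)

Section Concave.
Context {R : realType}.
Variables (b : R) (f : R -> R).
Hypothesis b_gt0 : 0 < b.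
Local Notation D := (prices b).
Hypothesis f_concave : strictly_concave_on D f.
Hypothesis f_decr : strictly_decreasing_on D f.
Hypothesis f_diff : differentiable_on D f.
Local Notation f' := (deriv_on D f).

Lemma pricesP x : D x <-> 0 <= x /\ x <= b.
Proof. by rewrite /prices /= in_itv /=; split => [/andP[]|[-> ->]]. Qed.

(* f is constrained on [0, b] only; fc agrees with it there and is continuous on
   the whole line. *)
Local Notation fc := (f \o clamp 0 b).

Lemma clamp_prices x : D (clamp 0 b x).
Proof. by apply/pricesP; exact/clamp_itv/ltW. Qed.

Lemma clamp_pricesE x : D x -> clamp 0 b x = x.
Proof. by move=> /pricesP[x0 xb]; exact: clamp_id. Qed.

(** Differentiability with the quotient multiplied out: it covers [y = x] and, at 0 and [b], the
    one-sided derivative. *)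
Lemma deriv_on_approx x eps : D x -> 0 < eps ->
  exists2 d, 0 < d & forall y, D y -> `|y - x| < d ->
    `|f y - f x - f' x * (y - x)| <= eps * `|y - x|.
Proof.
move=> Dx eps0.
have /cvgrPdist_lt/(_ _ eps0) : quotient_at D f x --> f' x by exact: f_diff.
rewrite /quotient_at /= near_withinE => /nbhs_ballP[d /= d0 dP].
exists d => // y Dy yxd.
have [->|yx] := eqVneq y x; first by rewrite !subrr mulr0 subr0 normr0 mulr0.
have yx0 : y - x != 0 by rewrite subr_eq0.
have := dP y; rewrite /ball /= distrC => /(_ yxd yx Dy) h.
have -> : f y - f x - f' x * (y - x) =
    - (f' x - (f y - f x) / (y - x)) * (y - x).
  by field.
by rewrite normrM normrN ler_wpM2r// ltW.
Qed.

(** If f(y) exceeded the tangent, concavity would keep f above the tangent by at least t times that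
    excess at distance t |y - x| from x, which the first-order expansion forbids for small t. *)
Lemma tangent_ge x y : D x -> D y -> f y <= f x + f' x * (y - x).
Proof.
move=> Dx Dy; have [->|yx] := eqVneq y x; first by rewrite subrr mulr0 addr0.
have n0 : 0 < `|y - x| by rewrite normr_gt0 subr_eq0.
rewrite leNgt; apply/negP => lt.
(* Half the excess per unit of distance: the expansion then allows only half of what concavity
   forces. *)
pose eps := (f y - (f x + f' x * (y - x))) / (2 * `|y - x|).
have eps0 : 0 < eps by rewrite divr_gt0// ?subr_gt0// mulr_gt0.
have epsE : 2 * (eps * `|y - x|) = f y - (f x + f' x * (y - x)).
  by rewrite /eps; field; rewrite gt_eqF.
have [d d0 dP] := deriv_on_approx Dx eps0.
pose t := Num.min (1 / 2) (d / (2 * `|y - x|)).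
have t0 : 0 < t by rewrite lt_min divr_gt0//= divr_gt0// mulr_gt0.
have t1 : t < 1 by rewrite gt_min; apply/orP; left; lra.
have td : t * `|y - x| < d.
  apply: (@le_lt_trans _ _ (d / (2 * `|y - x|) * `|y - x|)).
    by rewrite ler_pM2r// ge_min lexx orbT.
  have -> : d / (2 * `|y - x|) * `|y - x| = d / 2 by field; rewrite gt_eqF.
  lra.
have zE : t * y + (1 - t) * x - x = t * (y - x) by ring.
have Dz : D (t * y + (1 - t) * x).
  move/pricesP : Dx => [x0 xb]; move/pricesP : Dy => [y0 yb].
  by apply/pricesP; split; nra.
have := dP _ Dz; rewrite zE normrM gtr0_norm// => /(_ td).
have := f_concave Dy Dx yx t0 t1.
rewrite ler_norml => h /andP[_ h2].
suff : t * (2 * (eps * `|y - x|)) < t * (eps * `|y - x|).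
  by rewrite ltr_pM2l// => ?; have := mulr_gt0 eps0 n0; lra.
rewrite epsE; lra.
Qed.

(** With a positive slope the expansion with error f'(x) / 2 makes f increase near x. The
    contradiction is drawn to the right of x, or to the left when x = b. *)
Lemma deriv_on_le0 x : D x -> f' x <= 0.
Proof.
move=> Dx; have := pricesP x => -[/(_ Dx)[x0 xb] _].
rewrite leNgt; apply/negP => f'0.
have f2 : 0 < f' x / 2 by rewrite divr_gt0.
have [d d0 dP] := deriv_on_approx Dx f2.
have [xb'|bx] := ltP x b.
  pose y := Num.min b (x + d / 2).
  have yb : y <= b by rewrite ge_min lexx.
  have yd : y <= x + d / 2 by rewrite ge_min lexx orbT.
  have xy : x < y by rewrite lt_min xb' ltrDl divr_gt0.
  have Dy : D y by apply/pricesP; split => //; lra.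
  have nE : `|y - x| = y - x by rewrite gtr0_norm// subr_gt0.
  have := dP y Dy; rewrite nE => /(_ ltac:(lra)).
  rewrite ler_norml => /andP[h _]; have := f_decr Dx Dy xy.
  have : 0 < f' x * (y - x) by rewrite mulr_gt0// subr_gt0.
  lra.
pose y := Num.max 0 (x - d / 2).
have y0 : 0 <= y by rewrite le_max lexx.
have yd : x - d / 2 <= y by rewrite le_max lexx orbT.
have yx : y < x.
  by rewrite gt_max (lt_le_trans b_gt0 bx) ltrBlDr ltrDl divr_gt0.
have Dy : D y by apply/pricesP; split => //; lra.
have nE : `|y - x| = x - y by rewrite distrC gtr0_norm// subr_gt0.
have := dP y Dy; rewrite nE => /(_ ltac:(lra)).
rewrite ler_norml => /andP[_ h]; have := f_decr Dy Dx yx.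
have : 0 < f' x * (x - y) by rewrite mulr_gt0// subr_gt0.
lra.
Qed.

(** Add the tangent inequalities at x and at y. *)
Lemma deriv_on_anti x y : D x -> D y -> x < y -> f' y <= f' x.
Proof.
move=> Dx Dy xy; have := tangent_ge Dx Dy; have := tangent_ge Dy Dx.
move=> h1 h2; have yx : 0 < y - x by rewrite subr_gt0.
by rewrite -(ler_pM2r yx); lra.
Qed.

Local Notation d_b := (d_b b f).

(** As f' is nonpositive and nonincreasing, y f'(y) <= y f'(x) <= x f'(x); strictness comes from
    f. *)
Lemma d_b_decr x y : D x -> D y -> x < y -> d_b y < d_b x.
Proof.
move=> Dx Dy xy; have := f_decr Dx Dy xy; have := deriv_on_anti Dx Dy xy.
have := deriv_on_le0 Dx; have /pricesP[x0 _] := Dx; rewrite /d_b => *; nra.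
Qed.

Lemma continuous_prices x eps : D x -> 0 < eps ->
  exists2 d, 0 < d & forall y, D y -> `|y - x| < d -> `|f y - f x| < eps.
Proof.
move=> Dx eps0; have [d d0 dP] := deriv_on_approx Dx ltr01.
pose K := `|f' x| + 1.
have K0 : 0 < K by rewrite /K ltr_wpDl.
exists (Num.min d (eps / K)) => [|y Dy].
  by rewrite lt_min d0 divr_gt0.
rewrite lt_min ltr_pdivlMr// => /andP[yd yeps].
apply: le_lt_trans yeps.
have -> : f y - f x = (f y - f x - f' x * (y - x)) + f' x * (y - x) by ring.
apply: (le_trans (ler_normD _ _)); rewrite normrM /K.
by have := dP _ Dy yd; nra.
Qed.

Lemma extension_continuous : continuous fc.
Proof.
move=> x; apply/cvgrPdist_lt => eps eps0.
have [d d0 dP] := continuous_prices (clamp_prices x) eps0.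
near=> y; rewrite /= distrC; apply: dP; first exact: clamp_prices.
apply: (le_lt_trans (clamp_lipschitz (ltW b_gt0) _ _)); rewrite distrC.
by near: y; exact: cvgr_dist_lt.
Unshelve. all: by end_near. Qed.

(* The supremum is attained without continuity of f': replacing f'(x) by the
   slope of a secant from a fixed z < x, which dominates it, turns
   0 <= d_b(x) into a condition that is continuous in x. *)
Lemma exists_phi_b : f 0 = 1 ->
  exists p, is_max_of [set phi | D phi /\ 0 <= d_b phi] p.
Proof.
move=> f0; set S := [set phi | _].
have D0 : D 0 by apply/pricesP; split => //; exact: ltW.
have S0 : S 0 by split => //; rewrite /d_b f0 mulr0 mul0r addr0.
have Sb : ubound S b by move=> x [/pricesP[]].
have hS : has_sup S by split; [exists 0|exists b].
have s0 : 0 <= sup S by apply: ub_le_sup S0; exists b.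
have sb : sup S <= b by apply: ge_sup Sb; exists 0.
have Ds : D (sup S) by exact/pricesP.
exists (sup S); split; last by move=> x Sx; apply: ub_le_sup => //; exists b.
split => //; rewrite leNgt; apply/negP => ds.
have {}s0 : 0 < sup S.
  rewrite lt_neqAle s0 andbT; apply/eqP => s0E.
  by move: ds; rewrite -s0E ltNge; case: S0 => _ ->.
have fpos : 0 < 2 * sup S by lra.
(* With this error the secant slope from z to s = sup S changes d_b(s) by at most |d_b(s)| / 2, so
   the sign stays negative. *)
pose eps := - d_b (sup S) / (2 * (2 * sup S)).
have eps0 : 0 < eps by rewrite divr_gt0// ?oppr_gt0//; lra.
have epsE : 2 * (2 * sup S * eps) = - d_b (sup S).
  by rewrite /eps; field; rewrite gt_eqF.
have [d d0 dP] := deriv_on_approx Ds eps0.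
pose z := Num.max 0 (sup S - d / 2).
have z0 : 0 <= z by rewrite le_max lexx.
have zd : sup S - d / 2 <= z by rewrite le_max lexx orbT.
have zs : z < sup S by rewrite gt_max s0 /=; lra.
have Dz : D z by apply/pricesP; split => //; lra.
have nE : `|z - sup S| = sup S - z by rewrite distrC gtr0_norm// subr_gt0.
have := dP z Dz; rewrite nE => /(_ ltac:(lra)).
rewrite ler_norml => /andP[h _].
(* This is x - z times d_b(x) with the secant slope in place of f'(x). *)
pose G x := fc x * (x - z) + 2 * x * (fc x - f z).
have Gs : G (sup S) < 0.
  rewrite /G /= clamp_pricesE//.
  have fs : f (sup S) - f z <= (f' (sup S) + eps) * (sup S - z) by lra.
  have : 2 * sup S * (f (sup S) - f z) <=
      2 * sup S * ((f' (sup S) + eps) * (sup S - z)) by rewrite ler_pM2l.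
  have : (d_b (sup S) + 2 * sup S * eps) * (sup S - z) < 0.
    by rewrite nmulr_rlt0 ?subr_gt0//; lra.
  rewrite /d_b; nra.
have cG : {for sup S, continuous G}.
  have cf := @extension_continuous (sup S).
  have cid : {for sup S, continuous (@id R)} by exact: cvg_id.
  have cst (k : R) : {for sup S, continuous (fun _ : R => k)}.
    exact: cst_continuous.
  exact: (continuousD (continuousM cf (continuousB cid (cst z)))
    (continuousM (continuousM (cst 2) cid) (continuousB cf (cst (f z))))).
have [d' d'0 d'P] : exists2 d', 0 < d' & forall y, `|sup S - y| < d' -> G y < 0.
  have /nbhs_ballP[d' /= d'0 d'P] : \forall y \near sup S, G y < 0.
    exact: cvgr_lt cG _ Gs.
  by exists d' => // y yd; exact: d'P.
have d''0 : 0 < Num.min d' (sup S - z) by rewrite lt_min d'0 subr_gt0.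
(* A point of [S] so close to the supremum that z < x and G(x) < 0; the tangent at x gives 0 <=
   d_b(x) (x - z) <= G(x). *)
have [x Sx xs] := sup_adherent d''0 hS.
have xs' : x <= sup S by apply: ub_le_sup => //; exists b.
have : sup S - Num.min d' (sup S - z) < x by [].
rewrite ltrBlDr -ltrBlDl lt_min => /andP[xd xz].
have := d'P x; rewrite ger0_norm ?subr_ge0// => /(_ xd).
have [Dx dx] := Sx; rewrite /G /= clamp_pricesE// => Gx.
have zx : 0 < x - z by lra.
have := tangent_ge Dx Dz => tg.
have x0 : 0 <= x by have /pricesP[] := Dx.
have : 2 * x * (f' x * (x - z)) <= 2 * x * (f x - f z).
  by apply: ler_wpM2l; [rewrite mulr_ge0|lra].
have : 0 <= d_b x * (x - z) by rewrite mulr_ge0// ltW.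
rewrite /d_b; lra.
Qed.

(** * The margin h(x) = (f(x) - r) x *)

Section Margin.
Variable r : R.
Let h (x : R) : R := (f x - r) * x.

Lemma margin_continuous : continuous (fun x => (fc x - r) * x).
Proof.
move=> x; have cf := @extension_continuous x.
have cid : {for x, continuous (@id R)} by exact: cvg_id.
have cst : {for x, continuous (fun _ : R => r)} by exact: cst_continuous.
exact: (continuousM (continuousB cf cst) cid).
Qed.

(** Since f(x) - r >= f(x) / 2, the slope f(x) - r + x f'(x) of h is at least d_b(x) / 2. The
    parameter [d] lets the caller keep y close to x. *)
Lemma margin_gt x d : D x -> x < b -> 2 * r <= f x -> 0 < d_b x -> 0 < d ->
  exists y, [/\ D y, x < y, y < x + d & h x < h y].
Proof.
move=> Dx xb fr dx d0.
have x0 : 0 <= x by have /pricesP[] := Dx.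
have f'0 := deriv_on_le0 Dx.
have x1 : 0 < x + 1 by lra.
pose eps := d_b x / (8 * (x + 1)).
have eps0 : 0 < eps by rewrite divr_gt0// mulr_gt0.
have epsE : 8 * (eps * (x + 1)) = d_b x by rewrite /eps; field; rewrite gt_eqF.
have [d1 d10 dP] := deriv_on_approx Dx eps0.
have K0 : 0 < 8 * (1 - f' x) by lra.
(* These bounds keep both error terms, eps y and - f'(x) (y - x), at or below d_b(x) / 8, against a
   main term of at least d_b(x) / 2. *)
pose d2 := Num.min (Num.min d d1) (Num.min 1 (d_b x / (8 * (1 - f' x)))).
have d20 : 0 < d2 by rewrite !lt_min d0 d10 ltr01 divr_gt0.
pose y := Num.min b (x + d2 / 2).
have yb : y <= b by rewrite ge_min lexx.
have yd : y <= x + d2 / 2 by rewrite ge_min lexx orbT.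
have xy : x < y by rewrite lt_min xb ltrDl divr_gt0.
have : y - x < d2 by lra.
rewrite /d2 !lt_min ltr_pdivlMr// => /andP[/andP[yxd yxd1] /andP[yx1 yx2]].
have Dy : D y by apply/pricesP; split => //; lra.
exists y; split => //; first lra.
have nE : `|y - x| = y - x by rewrite gtr0_norm// subr_gt0.
have := dP y Dy; rewrite nE => /(_ yxd1); rewrite ler_norml => /andP[low _].
have yx0 : 0 < y - x by rewrite subr_gt0.
have y0 : 0 < y by lra.
have : (f' x - eps) * (y - x) * y <= (f y - f x) * y.
  by rewrite ler_pM2r//; lra.
have : 0 < ((f' x - eps) * y + f x - r) * (y - x).
  rewrite mulr_gt0//.
  have : eps * y <= eps * (x + 1) by rewrite ler_pM2l//; lra.
  have : f' x * (x - y) >= 0 by rewrite mulr_le0//; lra.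
  have : (y - x) * (8 * (1 - f' x)) =
      8 * (y - x) + 8 * (f' x * (x - y)) by ring.
  have : d_b x = f x + 2 * (x * f' x) by rewrite /d_b; ring.
  lra.
rewrite /h; lra.
Qed.

(** For q > p, f(q) < 2 r and d_b(q) <= 0 give f(q) - r + q f'(q) <= 0, and the tangent at q yields
    h(y) <= h(q). Continuity of h lets q tend to p, where the sign of [d_b] is not assumed. *)
Lemma margin_le p y : D p -> D y -> p <= y -> f p <= 2 * r ->
  (forall q, D q -> p < q -> d_b q <= 0) -> h y <= h p.
Proof.
move=> Dp Dy; rewrite le_eqVlt => /predU1P[->//|py] fp db.
rewrite leNgt; apply/negP => hpy.
pose G x := (fc x - r) * x.
have cG : {for p, continuous G} := @margin_continuous p.
have Gp : G p < h y by rewrite /G /= clamp_pricesE.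
have /nbhs_ballP[d d0 dP] : \forall z \near p, G z < h y.
  exact: cvgr_lt cG _ Gp.
have /pricesP[p0 pb] := Dp; have /pricesP[y0 yb] := Dy.
move: d0 => /= d0.
pose q := Num.min ((p + y) / 2) (p + d / 2).
have pq : p < q by rewrite lt_min; apply/andP; split; lra.
have qy : q <= (p + y) / 2 by rewrite ge_min lexx.
have qd : q <= p + d / 2 by rewrite ge_min lexx orbT.
have Dq : D q by apply/pricesP; split; lra.
have : G q < h y.
  by apply: dP; rewrite /ball /= distrC gtr0_norm ?subr_gt0//; lra.
rewrite /G /= clamp_pricesE// ltNge => /negP; apply.
have := tangent_ge Dq Dy; have := deriv_on_le0 Dq; have := db q Dq pq.
have := f_decr Dp Dq pq; rewrite /d_b /h => fq dq f'q tq.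
have yq : 0 < y - q by lra.
have : (f y - f q) * y <= f' q * (y - q) * y by rewrite ler_wpM2r//; lra.
have : (f' q * y + f q - r) * (y - q) <= 0.
  rewrite pmulr_lle0//.
  have : f' q * (y - q) <= 0 by rewrite mulr_le0_ge0// ltW.
  lra.
lra.
Qed.

(** Chebyshev's inequality: f decreases in x, so the weighted mean of f(x) x is at most the product
    of the means of f and x. Strict concavity of f, multiplied by a positive mean price, does the
    rest. *)
Lemma margin_concave : strictly_concave_on D h.
Proof.
move=> x y t Dx Dy xy t0 t1; rewrite /h.
have /pricesP[x0 xb] := Dx; have /pricesP[y0 yb] := Dy.
have fz := f_concave Dx Dy xy t0 t1.
have z0 : 0 < t * x + (1 - t) * y.
  have [x00|x00] := eqVneq x 0.
    rewrite x00 mulr0 add0r mulr_gt0 ?subr_gt0//.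
    by rewrite lt_neqAle y0 andbT -x00.
  have x1 : 0 < x by rewrite lt_neqAle eq_sym x00.
  by rewrite ltr_pwDl ?mulr_gt0// mulr_ge0// subr_ge0 ltW.
have : (t * f x + (1 - t) * f y) * (t * x + (1 - t) * y) <
   f (t * x + (1 - t) * y) * (t * x + (1 - t) * y) by rewrite ltr_pM2r.
have : 0 <= t * (1 - t) * ((f x - f y) * (y - x)).
  rewrite mulr_ge0//; first by rewrite mulr_ge0// ltW// subr_gt0.
  have [xly|ylx|xyE] := ltgtP x y.
  - by rewrite mulr_ge0// subr_ge0 ltW// f_decr.
  - by rewrite mulr_le0// subr_le0 ltW// f_decr.
  - by rewrite xyE eqxx in xy.
lra.
Qed.

Lemma margin_argmax : exists2 p, D p & forall y, D y -> h y <= h p.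
Proof.
pose G x := (fc x - r) * x.
have cG : continuous G := margin_continuous.
have [p pD pP] := EVT_max (ltW b_gt0) (continuous_subspaceT cG).
exists p; first by [].
move=> y Dy; have := pP y; rewrite /G /= !clamp_pricesE//; apply.
exact: Dy.
Qed.

(** A point strictly between x and the maximizer p has a value above a weighted mean of h(x) and
    h(p), which is at least h(x). For y = p the midpoint serves as intermediary. *)
Lemma margin_incr p x y : D p -> (forall z, D z -> h z <= h p) ->
  D x -> x < y -> y <= p -> h x < h y.
Proof.
move=> Dp hp Dx xy yp.
have /pricesP[x0 xb] := Dx; have /pricesP[p0 pb] := Dp.
have xp : x < p by lra.
have px0 : 0 < p - x by lra.
have strict (t : R) : 0 < t -> t < 1 -> h x < h (t * x + (1 - t) * p).
  move=> t0 t1; apply: le_lt_trans (margin_concave Dx Dp _ t0 t1); last first.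
    by rewrite lt_eqF.
  by have := hp x Dx; nra.
have [ypE|ypN] := eqVneq y p.
  have h1 : 1 / 2 < 1 :> R by lra.
  have /strict/(_ h1) h2 : 0 < 1 / 2 :> R by lra.
  rewrite ypE; apply: lt_le_trans h2 _; apply: hp.
  by apply/pricesP; split; lra.
have yp' : y < p by rewrite lt_neqAle ypN.
have -> : y = (p - y) / (p - x) * x + (1 - (p - y) / (p - x)) * p.
  by field; rewrite gt_eqF.
apply: strict; first by rewrite divr_gt0// subr_gt0.
by rewrite ltr_pdivrMr//; lra.
Qed.

Lemma margin_argmax_unique p q : D p -> (forall z, D z -> h z <= h p) ->
  D q -> (forall z, D z -> h z <= h q) -> p = q.
Proof.
move=> Dp hp Dq hq; have [pq|qp|//] := ltgtP p q.
- by have := margin_incr Dq hq Dp pq (lexx _); have := hp _ Dq; lra.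
- by have := margin_incr Dp hp Dq qp (lexx _); have := hq _ Dp; lra.
Qed.

End Margin.

End Concave.

(** * Probability measures with a continuous distribution function *)

Section ContinuousCdf.
Context {R : realType}.
Variables (G : R -> R) (a c : R).
Hypotheses (G_nd : nondecreasing G) (G_cont : continuous G).
Hypothesis G_a : forall x, x <= a -> G x = 0.
Hypothesis G_c : forall x, c <= x -> G x = 1.

(** The Lebesgue-Stieltjes measure of [G]; its constant tails provide the limits 0 and 1 at
    infinity. *)
Lemma probability_of_cdf : exists P : probability (measurableTypeR R) R,
  forall x, P `]-oo, x]%classic = (G x)%:E.
Proof.
have GNy : G @ -oo --> (0 : R).
  apply: cvg_near_cst; exists a; split; first exact: num_real.
  by move=> x /ltW /G_a ->.
have Gy : G @ +oo --> (1 : R).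
  apply: cvg_near_cst; exists c; split; first exact: num_real.
  by move=> x /ltW /G_c ->.
pose C1 := isCumulative.Build R _ R G G_nd (right_continuousW G_cont).
pose C2 := isCumulativeBounded.Build R 0 1 G GNy Gy.
pose F : cumulativeBounded (0 : R) (1 : R) := HB.pack_for
  (cumulativeBounded (0 : R) (1 : R)) G C1 C2.
exists (lebesgue_stieltjes_measure F).
exact: (cdf_lebesgue_stieltjes_id F).
Qed.

End ContinuousCdf.

Section CdfProbability.
Context {R : realType}.
Variables (P : probability (measurableTypeR R) R) (G : R -> R).
Hypotheses (G_cont : continuous G).
Hypothesis PG : forall x, P `]-oo, x]%classic = (G x)%:E.

Lemma cdf_itv_oc (x y : R) : x <= y -> P `]x, y]%classic = (G y - G x)%:E.
Proof.
move=> xy.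
have -> : `]x, y]%classic = `]-oo, y]%classic `\` `]-oo, x]%classic :> set R.
  apply/seteqP; split => z /=; rewrite !in_itv/=.
    by move=> /andP[xz zy]; split => //; apply/negP; rewrite -ltNge.
  by move=> [zy /negP]; rewrite -ltNge => xz; apply/andP.
have -> : P (`]-oo, y]%classic `\` `]-oo, x]%classic) =
    (P `]-oo, y]%classic - P `]-oo, x]%classic)%E.
  rewrite measureD//; last by rewrite -ge0_fin_numE// fin_num_measure.
  congr (_ - P _)%E; apply/seteqP; split => z /=; rewrite !in_itv/=.
    by case.
  by move=> zx; split => //; exact: le_trans xy.
by rewrite !PG EFinB.
Qed.

Lemma cdf_atomless (x : R) : P [set x] = 0%E.
Proof.
apply/eqP; rewrite eq_le measure_ge0 andbT.
apply/lee_addgt0Pr => eps eps0; rewrite add0e.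
have [d /= d0 dP] :
    exists2 d, 0 < d & forall y, `|x - y| < d -> `|G x - G y| < eps.
  have /cvgrPdist_lt/(_ _ eps0)/nbhs_ballP[d d0 dP] : G @ x --> G x.
    exact: G_cont.
  by exists d => // y xy; exact: dP.
pose y := x - d / 2.
have yx : y < x by rewrite ltrBlDr ltrDl divr_gt0.
apply: (@le_trans _ _ (P `]y, x]%classic)).
  apply: le_measure; rewrite ?inE//.
  by move=> z ->; rewrite /= in_itv/= yx lexx.
rewrite (cdf_itv_oc (ltW yx)) lee_fin (le_trans (ler_norm _))// ltW// dP//.
rewrite /y opprB addrC subrK gtr0_norm ?divr_gt0//; lra.
Qed.

Lemma cdf_itv_cc (x y : R) : x <= y -> P `[x, y]%classic = (G y - G x)%:E.
Proof.
move=> xy.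
have -> : `[x, y]%classic = [set x] `|` `]x, y]%classic :> set R.
  by rewrite setU1itv// bnd_simp.
have -> : P ([set x] `|` `]x, y]%classic) = (P [set x] + P `]x, y]%classic)%E.
  rewrite measureU//.
  by apply/seteqP; split => z //=; rewrite in_itv/= => -[->]; rewrite ltxx.
by rewrite cdf_atomless add0e cdf_itv_oc.
Qed.

Lemma cdf_supported (x y : R) : x < y -> G x = 0 -> G y = 1 ->
  {in `[x, y] &, {homo G : u v / u < v}} -> supported_over P `[x, y]%classic.
Proof.
move=> xy Gx Gy Ginc; split.
- exact: interval_closed.
- by rewrite cdf_itv_cc ?ltW// Gx Gy subr0.
- move=> U oU [z [Uz]] /=; rewrite in_itv/= => /andP[xz zy].
  have /nbhs_ballP[d /= d0 dP] : nbhs z U by exact: open_nbhs_nbhs.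
  (* The interval ]u, v] stays inside both [U] and [x, y], where the strict growth of [G] gives it
     positive mass. *)
  pose u := Num.max x (z - d / 2); pose v := Num.min y (z + d / 2).
  have ux : x <= u by rewrite le_max lexx.
  have vy : v <= y by rewrite ge_min lexx.
  have uz : u <= z by rewrite ge_max xz; lra.
  have zv : z <= v by rewrite le_min zy; lra.
  have ud : z - d / 2 <= u by rewrite le_max lexx orbT.
  have vd : v <= z + d / 2 by rewrite ge_min lexx orbT.
  have uv : u < v.
    by rewrite lt_min !gt_max xy; apply/andP; split; apply/andP; split; lra.
  apply: (@lt_le_trans _ _ (P `]u, v]%classic)).
    rewrite cdf_itv_oc ?ltW// lte_fin subr_gt0; apply: Ginc => //.
      by rewrite in_itv/= ux; lra.
    by rewrite in_itv/= vy andbT; lra.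
  apply: le_measure; rewrite ?inE//.
    exact: open_measurable.
  move=> w; rewrite /= in_itv/= => /andP[uw wv]; apply: dP.
  by rewrite /ball/= ltr_norml; apply/andP; split; lra.
Qed.

(** Here [k] stands for the payoff of the price x against an opponent's price y: constant on either
    side of x within the carrier [A]. The tie y = x and the complement of [A] are null sets. *)
Lemma integral_step (D A : set R) (k : R -> \bar R) (x k1 k2 : R) :
  measurable D -> measurable A -> P A = 1%E -> A `<=` D ->
  measurable_fun D k -> (forall y, D y -> 0 <= k y)%E -> 0 <= k1 -> 0 <= k2 ->
  (forall y, A y -> y < x -> k y = k1%:E) ->
  (forall y, A y -> x < y -> k y = k2%:E) ->
  (\int[P]_(y in D) k y = (k1 * G x + k2 * (1 - G x))%:E)%E.
Proof.
move=> mD mA PA AD mk k0 k10 k20 kl kr.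
have mI : measurable [set x] by exact: measurable_set1.
pose g y : \bar R := (if y <= x then k1 else k2)%:E.
have mg : measurable_fun setT g.
  apply/measurable_EFinP; apply: measurable_fun_ifT => //.
  have mid : measurable_fun [set: R] (@idfun R) by exact: measurable_id.
  have mx : measurable_fun [set: R] (cst x) by exact: measurable_cst.
  exact: (measurable_fun_ler mid mx).
have g0 y : (0 <= g y)%E by rewrite lee_fin; case: ifP.
have -> : (\int[P]_(y in D) k y = \int[P]_y g y)%E.
  rewrite integral_mkcond; apply: ge0_ae_eq_integral => //.
  - exact: ((measurable_restrictT _ mD).1 mk).
  - by move=> y _; apply: erestrict_ge0.
  exists (~` A `|` [set x]); split.
  - by apply: measurableU => //; exact: measurableC.
  - apply/eqP; rewrite eq_le measure_ge0 andbT.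
    apply: (@le_trans _ _ (P (~` A) + P [set x])%E).
      by apply: measureU2 => //; exact: measurableC.
    by rewrite cdf_atomless adde0 probability_setC// PA subee.
  - move=> y /= /not_implyP[_ h].
    apply: contrapT => /not_orP[/contrapT Ay /eqP yx].
    apply: h; rewrite /g patchT ?inE; last exact: AD.
    case: ltgtP yx => // xy _; first exact: kl.
    exact: kr.
rewrite -(setUv (`]-oo, x]%classic : set R)) ge0_integral_setU//=; last 3 first.
- exact: measurableC.
- exact: measurable_funTS.
- exact/disj_setPCl.
rewrite (eq_integral (cst k1%:E)); last first.
  by move=> y; rewrite inE/= in_itv/= /g => ->.
rewrite [X in (_ + X)%E](eq_integral (cst k2%:E)); last first.
  by move=> y; rewrite inE/= in_itv/= /g => /negP/negbTE ->.
rewrite !integral_cst//=; last exact: measurableC.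
by rewrite probability_setC// !PG EFinD !EFinM EFinB.
Qed.

End CdfProbability.

(** * Expected payoffs as iterated integrals *)

Section ExpectedPayoff.
Context {R : realType}.
Variables (D : set R) (u v : R -> R -> R).
Hypothesis mD : measurable D.
Hypothesis mv :
  measurable_fun [set: measurableTypeR R * measurableTypeR R]
    (fun p => v p.1 p.2).
Hypothesis uv : forall x y, D x -> D y -> u x y = v x y.
Hypothesis u_ge0 : forall x y, D x -> D y -> 0 <= u x y.
Implicit Types s t : probability (measurableTypeR R) R.

(** Extension by zero turns integrals over the square of [D] into integrals over the plane, where
    Tonelli's theorem applies. Measurability comes from [v], which agrees with [u] on that
    square. *)
Let w : measurableTypeR R * measurableTypeR R -> \bar R :=
  (fun p => (v p.1 p.2)%:E) \_ (D `*` D).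

Let w_ge0 p : (0 <= w p)%E.
Proof.
by apply: erestrict_ge0 => -[x y] [/= Dx Dy]; rewrite lee_fin -uv// u_ge0.
Qed.

Let mw : measurable_fun setT w.
Proof.
have mDD : measurable (D `*` D : set (measurableTypeR R * measurableTypeR R)).
  exact: measurableX.
have mwE := measurable_restrictT
  (fun p : measurableTypeR R * measurableTypeR R => (v p.1 p.2)%:E) mDD.
apply: mwE.1.
apply: measurable_funTS.
exact: ((measurable_EFinP _ _).2 mv).
Qed.

Let wE x : D x -> (fun y => w (x, y)) = (fun y => (v x y)%:E) \_ D.
Proof.
move=> Dx; apply/funext => y; rewrite /w /patch.
by rewrite in_setX/= (mem_set Dx).
Qed.

Let wN x : ~ D x -> (fun y => w (x, y)) = cst 0%E.
Proof.
move=> Dx; apply/funext => y; rewrite /w /patch.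
by rewrite in_setX/= (memNset Dx).
Qed.

Lemma measurable_section x : D x -> measurable_fun D (fun y => (u x y)%:E).
Proof.
move=> Dx; apply: (eq_measurable_fun (fun y => (v x y)%:E)) => [y|].
  by rewrite inE => Dy; rewrite uv.
apply: measurable_funTS.
exact: ((measurable_EFinP _ _).2 (measurable_fun_pair2 x mv)).
Qed.

Let eE s t : expected_payoff D u s t = (\int[s \x t]_p w p)%E.
Proof.
rewrite /expected_payoff (eq_integral
  (fun p : measurableTypeR R * measurableTypeR R => (v p.1 p.2)%:E));
  last first.
  by move=> [x y]; rewrite inE => -[/= Dx Dy]; rewrite uv.
by rewrite integral_mkcond.
Qed.

Let inner t : (fun x => \int[t]_y w (x, y))%E =
  (fun x => \int[t]_(y in D) (u x y)%:E)%E \_ D.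
Proof.
apply/funext => x; rewrite /patch; case: ifPn; rewrite ?inE => Dx.
  rewrite wE// -integral_mkcond; apply: eq_integral => y; rewrite inE => Dy.
  by rewrite uv.
by rewrite wN ?integral0//; move: Dx; rewrite notin_setE.
Qed.

Lemma expected_payoffE s t : expected_payoff D u s t =
  (\int[s]_(x in D) \int[t]_(y in D) (u x y)%:E)%E.
Proof.
by rewrite eE fubini_tonelli1// /fubini_F inner -integral_mkcond.
Qed.

Lemma measurable_expected t :
  measurable_fun D (fun x => \int[t]_(y in D) (u x y)%:E)%E.
Proof.
apply: ((measurable_restrictT _ mD).2 _); rewrite -inner.
exact: measurable_fun_fubini_tonelli_F.
Qed.

(** Integrating in the other order reduces the payoff of player 2 to that of player 1. *)
Lemma expected_payoff_swap s t :
  expected_payoff D (fun x y => u y x) s t = expected_payoff D u t s.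
Proof.
rewrite expected_payoffE /expected_payoff.
rewrite (eq_integral (fun p : measurableTypeR R * measurableTypeR R =>
  (v p.2 p.1)%:E)); last first.
  by move=> [x y]; rewrite inE => -[/= Dx Dy]; rewrite uv.
rewrite integral_mkcond.
transitivity (\int[s \x t]_p w (p.2, p.1))%E.
  by apply: eq_integral => -[x y] _; rewrite /w /patch !in_setX/= andbC.
rewrite fubini_tonelli2//; last first.
  by apply: (measurableT_comp mw); exact: measurable_swap.
by rewrite /fubini_G /= inner -integral_mkcond.
Qed.

End ExpectedPayoff.

(** * Symmetric pure equilibria *)

Section PureEquilibria.
Context {R : realType}.
Variables (b : R) (f : R -> R) (Lam e : R).
Hypothesis b_gt0 : 0 < b.
Local Notation D := (prices b).
Hypothesis f_concave : strictly_concave_on D f.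
Hypothesis f_decr : strictly_decreasing_on D f.
Hypothesis f_diff : differentiable_on D f.
Hypothesis f_range : forall x, D x -> 0 < f x /\ f x <= 1.
Hypothesis f_0 : f 0 = 1.
Hypotheses (Lam_gt0 : 0 < Lam) (e_gt0 : 0 < e).
Local Notation r := (rho Lam e).
Local Notation M1 := (M1 f Lam e).
Local Notation M2 := (M2 f Lam e).
Local Notation h := (fun x => (f x - r) * x).
Local Notation fc := (f \o clamp 0 b).

Lemma rho_gt0 : 0 < r.
Proof. exact: divr_gt0. Qed.

Lemma mul_rho : Lam * r = e.
Proof. by rewrite /rho; field; rewrite gt_eqF. Qed.

Lemma m_margin x : m f Lam e x = Lam * h x.
Proof. by rewrite /m -{1}mul_rho; ring. Qed.

Lemma M2E x y : M2 x y = M1 y x.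
Proof.
by rewrite /Defs.M2 /Defs.M1 (eq_sym y); case: ltgtP.
Qed.

Lemma M1_diag x : M1 x x = payoff_tie f Lam e x.
Proof. by rewrite /Defs.M1 ltxx eqxx. Qed.

Lemma M1_high x y : y < x -> M1 x y = payoff_high f Lam e x.
Proof. by rewrite /Defs.M1 => ->. Qed.

Lemma M1_low x y : x < y -> M1 x y = payoff_low f Lam e y x.
Proof. by move=> xy; rewrite /Defs.M1 ltNge ltW//= lt_eqF. Qed.

Lemma pure_nash_diag x :
  pure_nash D M1 M2 x x <-> D x /\ forall y, D y -> M1 y x <= M1 x x.
Proof.
split=> [[Dx _ H _]|[Dx H]]; split => // y Dy.
by rewrite !M2E; exact: H.
Qed.

Lemma f_le x y : D x -> D y -> x <= y -> f y <= f x.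
Proof.
by move=> Dx Dy; rewrite le_eqVlt => /predU1P[->//|/f_decr h]; exact/ltW/h.
Qed.

Lemma lt_of_f_lt x y : D x -> D y -> f y < f x -> x < y.
Proof.
move=> Dx Dy; rewrite ltNge => fxy; rewrite ltNge.
by apply: contra fxy; exact: f_le.
Qed.

Lemma prices0 : D 0.
Proof. by apply/pricesP; split => //; exact: ltW. Qed.

Lemma M1_ge0 x y : D x -> D y -> 0 <= M1 x y.
Proof.
move=> Dx Dy; have [/pricesP[x0 _] [fx0 _]] := (Dx, f_range Dx).
have e0 := ltW e_gt0; have L0 := ltW Lam_gt0.
rewrite /Defs.M1; case: ifP => _; last case: ifP => _.
- rewrite /payoff_high; case: ifP => _; first exact: mulr_ge0.
  case: ifPn => // rf; rewrite m_margin mulr_ge0// mulr_ge0// subr_ge0.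
  exact: ltW.
- rewrite /payoff_tie; case: ifP => _; first exact: mulr_ge0.
  by rewrite mulr_ge0// mulr_ge0// ?divr_ge0// ltW.
- rewrite /payoff_low; do 2 (case: ifP => _; first exact: mulr_ge0).
  by rewrite mulr_ge0// le_min e0 mulr_ge0// ltW.
Qed.

(** By continuity f stays above 2 rho slightly above x, where the payoff is still e times the
    price. *)
Lemma tie_raise x : D x -> x < b -> 2 * r < f x ->
  exists2 y, D y & M1 x x < M1 y x.
Proof.
move=> Dx xb rf; have := rf; rewrite -subr_gt0 => eps0.
have [d d0 dP] := continuous_prices f_diff Dx eps0.
have /pricesP[x0 _] := Dx.
pose y := Num.min b (x + d / 2).
have yb : y <= b by rewrite ge_min lexx.
have yd : y <= x + d / 2 by rewrite ge_min lexx orbT.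
have xy : x < y by rewrite lt_min xb ltrDl divr_gt0.
have Dy : D y by apply/pricesP; split => //; lra.
have fy : 2 * r < f y.
  have := dP y Dy; rewrite gtr0_norm ?subr_gt0// => /(_ ltac:(lra)).
  by rewrite ltr_norml => /andP[]; lra.
exists y => //.
by rewrite M1_diag M1_high// /payoff_tie /payoff_high rf fy ltr_pM2l.
Qed.

(** A lower price y earns at least K y with K = min(e, Lam f(x)), while the tie earns Lam f(x) x / 2
    < K x; so y close to x is better. *)
Lemma tie_undercut x : D x -> 0 < x -> f x < 2 * r ->
  exists2 y, D y & M1 x x < M1 y x.
Proof.
move=> Dx x0 fr; have [fx0 _] := f_range Dx.
have /pricesP[_ xb] := Dx.
have rf : (2 * r < f x) = false by rewrite ltNge ltW.
pose K := Num.min e (Lam * f x).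
have K0 : 0 < K by rewrite lt_min e_gt0 mulr_gt0.
have tK : Lam / 2 * f x * x < K * x.
  rewrite ltr_pM2r// lt_min; have := mulr_gt0 Lam_gt0 fx0.
  have : Lam * f x < Lam * (2 * r) by rewrite ltr_pM2l.
  by have := mul_rho => ? ? ?; apply/andP; split; lra.
(* The break-even price: K q is the tie payoff. Any y strictly between q and x will do. *)
pose q := Lam / 2 * f x * x / K.
have qx : q < x by rewrite ltr_pdivrMr// [ltRHS]mulrC.
have q0 : 0 <= q by rewrite ltW// divr_gt0// mulr_gt0// mulr_gt0// divr_gt0.
pose y := (q + x) / 2.
have yx : y < x by rewrite /y; lra.
have qy : q < y by rewrite /y; lra.
have y0 : 0 <= y by lra.
have Dy : D y by apply/pricesP; split => //; lra.
exists y => //; rewrite M1_diag /payoff_tie rf M1_low// /payoff_low rf.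
apply: (@lt_le_trans _ _ (K * y)); first by rewrite [ltRHS]mulrC -ltr_pdivrMr.
case: ifP => _; first by rewrite ler_wpM2r// ge_min lexx.
rewrite ler_wpM2r// le_min ge_min lexx /= ge_min; apply/orP; right.
by rewrite ler_pM2l// ltW// f_decr.
Qed.

Lemma f_inv_prices z : 0 < z -> z <= 1 -> f b <= z ->
  D (f_inv b f z) /\ f (f_inv b f z) = z.
Proof.
move=> z0 z1 bz; rewrite /f_inv ltNge bz /= z1.
have cfc := continuous_subspaceT (extension_continuous b_gt0 f_diff).
have Db : D b by apply/pricesP; split => //; exact: ltW.
have [||c cD cz] := @IVT R fc 0 b z (ltW b_gt0).
- exact: cfc.
- rewrite /= !clamp_pricesE ?f_0//; last exact: prices0.
  by rewrite ge_min bz orbT le_max z1.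
have ex : exists y, [set phi | D phi /\ f phi = z] y.
  exists c; split; first exact: cD.
  by move: cz; rewrite /= clamp_pricesE.
exact: (xgetPex 0 ex).
Qed.

Section Threshold.
Variable p : R.
Hypothesis p_max : is_max_of [set phi | D phi /\ 0 <= d_b b f phi] p.

Lemma phi_b_prices : D p.
Proof. by case: p_max => -[]. Qed.

Lemma d_b_gt0 x : D x -> x < p -> 0 < d_b b f x.
Proof.
move=> Dx xp; case: p_max => -[Dp dp] _.
by apply: (le_lt_trans dp); exact: (d_b_decr b_gt0).
Qed.

Lemma d_b_le0 x : D x -> p < x -> d_b b f x <= 0.
Proof.
move=> Dx px; rewrite leNgt; apply/negP => dx.
case: p_max => _ /(_ x); rewrite leNgt px => /(_ _)/negP; apply=> //.
by split => //; exact: ltW.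
Qed.

Lemma pure_nash_threshold : r <= f p / 2 ->
  unique (fun x => pure_nash D M1 M2 x x) (f_inv b f (2 * r)).
Proof.
move=> rp; have Dp := phi_b_prices.
have r0 := rho_gt0.
have [fp0 fp1] := f_range Dp.
have Db : D b by apply/pricesP; split => //; exact: ltW.
have /pricesP[p0 pb] := Dp.
have fpb : f b <= f p by exact: f_le.
(* If 2 rho < f(b), then [f_inv] takes its boundary value b, every price has f > 2 rho, and each
   player earns e times the own price. *)
have [rb|br] := ltP (2 * r) (f b).
  have qE : f_inv b f (2 * r) = b by rewrite /f_inv rb.
  have rall x : D x -> 2 * r < f x.
    move=> Dx; apply: (lt_le_trans rb); apply: f_le => //.
    by have /pricesP[] := Dx.
  rewrite qE; split.
    apply/pure_nash_diag; split => // y Dy.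
    have /pricesP[y0 yb] := Dy.
    rewrite M1_diag /payoff_tie rb.
    move: yb; rewrite le_eqVlt => /predU1P[->|yb].
      by rewrite M1_diag /payoff_tie rb.
    by rewrite M1_low// /payoff_low rb ler_pM2l// ltW.
  move=> x /pure_nash_diag[Dx Hx].
  have /pricesP[x0 xb] := Dx.
  apply/eqP; rewrite eq_le xb andbT leNgt; apply/negP => xb'.
  have [y Dy] := tie_raise Dx xb' (rall _ Dx).
  by rewrite ltNge Hx.
have [//||Dq fq] := f_inv_prices _ _ br; [lra|lra|].
set q := f_inv b f (2 * r) in Dq fq *.
have /pricesP[q0 qb] := Dq.
have pq : p <= q.
  by rewrite leNgt; apply/negP => qp; have := f_decr Dq Dp qp; lra.
have Lr := mul_rho.
split.
  apply/pure_nash_diag; split => // y Dy; have /pricesP[y0 yb] := Dy.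
  have qq : M1 q q = e * q.
    by rewrite M1_diag /payoff_tie fq ltxx -[in RHS]Lr; field.
  rewrite qq.
  have [yq|qy|->] := ltgtP y q.
  - rewrite M1_low// /payoff_low fq ltxx.
    have -> : r < 2 * r by lra.
    by rewrite ler_pM2l// ltW.
  - rewrite M1_high// /payoff_high.
    have fy := f_decr Dq Dy qy.
    have -> : (2 * r < f y) = false by apply/negbTE; rewrite -leNgt; lra.
    case: ifP => _; last by rewrite mulr_ge0// ltW.
    have -> : e * q = Lam * h q by rewrite /= fq -[in LHS]Lr; ring.
    rewrite m_margin ler_pM2l//.
    (* Raising the price replaces e q = Lam h(q) by at most Lam h(y); as p <= q, [d_b] is
       nonpositive beyond q. *)
    apply: (margin_le b_gt0 f_concave f_decr f_diff) => //; first exact: ltW.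
      by rewrite fq.
    by move=> z Dz qz; apply: d_b_le0 => //; lra.
  - by rewrite qq.
move=> x /pure_nash_diag[Dx Hx]; have /pricesP[x0 xb] := Dx.
(* Uniqueness: raise if f(x) > 2 rho, possible since f(b) <= 2 rho; undercut if f(x) < 2 rho,
   possible since then x > p >= 0; equality forces x = q by injectivity. *)
have [rx|xr|fx] := ltgtP (2 * r) (f x).
- have xb' : x < b by apply: lt_of_f_lt => //; lra.
  have [y Dy] := tie_raise Dx xb' rx.
  by rewrite ltNge Hx.
- have px : p < x by apply: lt_of_f_lt => //; lra.
  have x0' : 0 < x by lra.
  have [y Dy] := tie_undercut Dx x0' xr.
  by rewrite ltNge Hx.
- apply/eqP; rewrite eq_le; apply/andP; split; rewrite leNgt; apply/negP => lt.
    by have := f_decr Dx Dq lt; lra.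
  by have := f_decr Dq Dx lt; lra.
Qed.

Lemma no_pure_nash : f p / 2 < r -> r < 1 -> ~ exists x, pure_nash D M1 M2 x x.
Proof.
move=> pr r1 [x /pure_nash_diag[Dx Hx]].
have Dp := phi_b_prices; have r0 := rho_gt0; have Lr := mul_rho.
have /pricesP[x0 xb] := Dx; have /pricesP[p0 pb] := Dp.
have [rx|xr|fx] := ltgtP (2 * r) (f x).
- have xp : x < p by apply: lt_of_f_lt => //; lra.
  have [y Dy] := tie_raise Dx (lt_le_trans xp pb) rx.
  by rewrite ltNge Hx.
- have [x00|x0'] : x = 0 \/ 0 < x.
  + by move: x0; rewrite le_eqVlt => /predU1P[<-|]; [left|right].
  (* At x = 0 the tie earns nothing and there is no room below; continuity at 0 gives y > 0 with
     f(y) > rho, which earns a positive amount. *)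
  + have r10 : 0 < 1 - r by lra.
    have [d d0 dP] := continuous_prices f_diff Dx r10.
    pose y := Num.min b (d / 2).
    have yb : y <= b by rewrite ge_min lexx.
    have yd : y <= d / 2 by rewrite ge_min lexx orbT.
    have y0 : 0 < y by rewrite lt_min b_gt0 divr_gt0.
    have Dy : D y by apply/pricesP; split => //; lra.
    have := dP y Dy; rewrite x00 subr0 f_0 (gtr0_norm y0) => /(_ ltac:(lra)).
    rewrite ltr_norml => /andP[fy _].
    have := Hx y Dy; rewrite x00 M1_diag M1_high// leNgt => /negP; apply.
    rewrite /payoff_tie /payoff_high !mulr0 if_same.
    case: ifP => _; first exact: mulr_gt0.
    rewrite m_margin; have -> : r < f y by lra.
    by rewrite mulr_gt0// mulr_gt0//; lra.
  + have [y Dy] := tie_undercut Dx x0' xr.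
    by rewrite ltNge Hx.
(* Here f(x) = 2 rho > f(p), so d_b(x) > 0 and a slightly larger y raises h. The tie payoff equals
   Lam h(x), and y earns Lam h(y) as long as f(y) > rho. *)
- have xp : x < p by apply: lt_of_f_lt => //; lra.
  have [d d0 dP] := continuous_prices f_diff Dx r0.
  have frx : 2 * r <= f x by rewrite fx.
  have [y [Dy xy yd hxy]] := margin_gt b_gt0 f_decr f_diff Dx
    (lt_le_trans xp pb) frx (d_b_gt0 Dx xp) d0.
  have := dP y Dy; rewrite gtr0_norm ?subr_gt0// => /(_ ltac:(lra)).
  rewrite ltr_norml => /andP[fy _].
  have fyx := f_decr Dx Dy xy.
  have := Hx y Dy; rewrite M1_diag M1_high// leNgt => /negP; apply.
  rewrite /payoff_tie /payoff_high fx ltxx.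
  have -> : (f x < f y) = false by apply/negbTE; rewrite -leNgt ltW.
  have -> : r < f y by lra.
  rewrite m_margin.
  have -> : Lam / 2 * f x * x = Lam * h x by rewrite /= -fx; field.
  by rewrite ltr_pM2l.
Qed.

End Threshold.

End PureEquilibria.

(** * The mixed equilibrium, and approximate equilibria at small prices *)

Section MixedEquilibria.
Context {R : realType}.
Variables (b : R) (f : R -> R) (Lam e : R).
Hypothesis b_gt0 : 0 < b.
Local Notation D := (prices b).
Hypothesis f_concave : strictly_concave_on D f.
Hypothesis f_decr : strictly_decreasing_on D f.
Hypothesis f_diff : differentiable_on D f.
Hypothesis f_range : forall x, D x -> 0 < f x /\ f x <= 1.
Hypothesis f_0 : f 0 = 1.
Hypotheses (Lam_gt0 : 0 < Lam) (e_gt0 : 0 < e).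
Local Notation r := (rho Lam e).
Local Notation M1 := (M1 f Lam e).
Local Notation M2 := (M2 f Lam e).
Local Notation h := (fun x => (f x - r) * x).
Local Notation fc := (f \o clamp 0 b).

(** As f(0) = 1 > rho, h is positive near 0, hence at q, which gives the first two bounds. If f(q)
    >= 2 rho > f(p), then q < p and [margin_gt] would improve on q. *)
Lemma argmax_between p q : is_max_of [set phi | D phi /\ 0 <= d_b b f phi] p ->
  f p / 2 < r -> r < 1 -> D q -> (forall z, D z -> h z <= h q) ->
  [/\ 0 < q, r < f q & f q < 2 * r].
Proof.
move=> p_max pr r1 Dq hq; have r0 := rho_gt0 Lam_gt0 e_gt0.
have Dp := phi_b_prices p_max.
have /pricesP[p0 pb] := Dp; have /pricesP[q0 qb] := Dq.
have [y Dy hy] : exists2 y, D y & 0 < h y.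
  have r10 : 0 < 1 - r by lra.
  have [d d0 dP] := continuous_prices f_diff (prices0 b_gt0) r10.
  pose y := Num.min b (d / 2).
  have yb : y <= b by rewrite ge_min lexx.
  have yd : y <= d / 2 by rewrite ge_min lexx orbT.
  have y0 : 0 < y by rewrite lt_min b_gt0 divr_gt0.
  have Dy : D y by apply/pricesP; split => //; lra.
  have := dP y Dy; rewrite subr0 f_0 (gtr0_norm y0) => /(_ ltac:(lra)).
  rewrite ltr_norml => /andP[fy _].
  by exists y => //; rewrite mulr_gt0//; lra.
have hq0 : 0 < h q by exact: lt_le_trans (hq _ Dy).
have q0' : 0 < q.
  rewrite lt_neqAle q0 andbT; apply/eqP => q0E.
  by move: hq0; rewrite -q0E mulr0 ltxx.
split => //; first by move: hq0; rewrite pmulr_lgt0// subr_gt0.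
rewrite ltNge; apply/negP => rq.
have qp : q < p by apply: (lt_of_f_lt f_decr) => //; lra.
have dq := d_b_gt0 b_gt0 f_concave f_decr f_diff p_max Dq qp.
have [y' [Dy' _ _]] := margin_gt b_gt0 f_decr f_diff Dq
  (lt_le_trans qp pb) rq dq ltr01.
by rewrite ltNge hq.
Qed.

Section MixedEquilibrium.
Variable q : R.
Hypotheses (Dq : D q) (hq : forall z, D z -> h z <= h q).
Hypotheses (q_gt0 : 0 < q) (rq : r < f q) (qr : f q < 2 * r).
Let L : R := h q / r.
Let r_gt0 : 0 < r := rho_gt0 Lam_gt0 e_gt0.

Let q_le : q <= b. Proof. by have /pricesP[] := Dq. Qed.

Let hqE : h q = r * L.
Proof. by rewrite /L [RHS]mulrC divfK// gt_eqF. Qed.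

Let L_gt0 : 0 < L.
Proof. by rewrite divr_gt0// mulr_gt0// subr_gt0. Qed.

Let L_lt : L < q.
Proof.
rewrite ltr_pdivrMr// mulrC ltr_pM2l//.
by rewrite ltrBlDr -mulr2n -mulr_natl.
Qed.

(** The last bound: f(x) >= 2 rho would give h(x) >= rho x >= rho L = h(q), so x = q by uniqueness
    of the maximizer, against f(q) < 2 rho. *)
Let itvP x : L <= x -> x <= q -> [/\ D x, 0 < x, r < f x & f x < 2 * r].
Proof.
move=> Lx xq; have x0 : 0 < x by exact: lt_le_trans Lx.
have Dx : D x by apply/pricesP; split; [exact: ltW|exact: le_trans q_le].
split => //; first by apply: (lt_le_trans rq); exact: (f_le f_decr).
rewrite ltNge; apply/negP => rx.
have : h q <= h x.
  rewrite hqE; have : r * L <= r * x by rewrite ler_pM2l.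
  have : 0 <= (f x - 2 * r) * x by rewrite mulr_ge0 ?subr_ge0// ltW.
  lra.
move=> qx; have xqE : x = q.
  apply: (margin_argmax_unique f_concave f_decr Dx _ Dq hq) => z Dz.
  exact: le_trans (hq Dz) qx.
by move: rx; rewrite xqE leNgt qr.
Qed.

Let g x : R := h x / r.

Let g_lt x : L <= x -> x <= q -> g x < x.
Proof.
move=> Lx xq; have [Dx x0 _ fx] := itvP Lx xq.
rewrite ltr_pdivrMr// mulrC ltr_pM2l//; lra.
Qed.

Let g_incr x y : L <= x -> x < y -> y <= q -> g x < g y.
Proof.
move=> Lx xy yq; have [Dx _ _ _] := itvP Lx (ltW (lt_le_trans xy yq)).
rewrite ltr_pM2r ?invr_gt0//.
exact: (margin_incr f_concave f_decr Dq hq Dx xy yq).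
Qed.

Let F x : R := (x - L) / (x - g x).

Let F_incr x y : L <= x -> x < y -> y <= q -> F x < F y.
Proof.
move=> Lx xy yq.
have xq := ltW (lt_le_trans xy yq); have Ly := ltW (le_lt_trans Lx xy).
have gx := g_lt Lx xq; have gy := g_lt Ly yq; have gxy := g_incr Lx xy yq.
have gyL : g y <= L.
  rewrite /g /L ler_pM2r ?invr_gt0//.
  by have [+ _ _ _] := itvP Ly yq; exact: hq.
rewrite /F ltr_pdivrMr ?subr_gt0// mulrAC ltr_pdivlMr ?subr_gt0//.
(* After cross-multiplication the difference of the two sides is (y - x) (L - g(x)) + (x - L) (g(y)
   - g(x)). *)
have : 0 < (y - x) * (L - g x) by rewrite mulr_gt0//; lra.
have : 0 <= (x - L) * (g y - g x) by rewrite mulr_ge0//; lra.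
lra.
Qed.

(** Clamping the argument provides the constant tails F(L) = 0 and F(q) = 1 of a distribution
    function. *)
Let G x : R := F (clamp L q x).

Let G_id x : L <= x -> x <= q -> G x = F x.
Proof. by move=> Lx xq; rewrite /G clamp_id. Qed.

Let F_L : F L = 0.
Proof. by rewrite /F subrr mul0r. Qed.

Let F_q : F q = 1.
Proof. by rewrite /F divff// subr_eq0 gt_eqF. Qed.

Let G_le x : x <= L -> G x = 0.
Proof. by move=> xL; rewrite /G clamp_le// F_L. Qed.

Let G_ge x : q <= x -> G x = 1.
Proof. by move=> qx; rewrite /G clamp_ge ?F_q// ltW. Qed.

Let G_nd : nondecreasing G.
Proof.
move=> x y xy; rewrite /G.
have [xL xq] := clamp_itv (ltW L_lt) x; have [yL yq] := clamp_itv (ltW L_lt) y.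
have := clamp_nd L q xy; rewrite le_eqVlt => /predU1P[->//|lt].
exact/ltW/F_incr.
Qed.

Let G_cont : continuous G.
Proof.
move=> x; have [Lx xq] := clamp_itv (ltW L_lt) x.
have -> : G = (fun y => (clamp L q y - L) /
    (clamp L q y - (fc (clamp L q y) - r) * clamp L q y / r)).
  apply/funext => y; have [Ly yq] := clamp_itv (ltW L_lt) y.
  have [Dy _ _ _] := itvP Ly yq.
  by rewrite /G /F /g /= clamp_pricesE.
have cl : {for x, continuous (clamp L q)}.
  exact: clamp_continuous (ltW L_lt) _.
have cst (k : R) : {for x, continuous (fun _ : R => k)}.
  exact: cst_continuous.
have ch : {for x, continuous (fun y => (fc (clamp L q y) - r) * clamp L q y)}.
  exact: (continuous_comp cl (@margin_continuous _ _ _ b_gt0 f_diff r _)).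
have cd := continuousB cl (continuousM ch (cst r^-1)).
have [Dx _ _ _] := itvP Lx xq.
apply: (continuousM (continuousB cl (cst L)) (continuousV _ cd)).
by rewrite !fctE /= clamp_pricesE// subr_eq0 gt_eqF// g_lt.
Qed.

(** The payoff built from the continuous extension of f: measurable on the whole plane and equal to
    [M1] on admissible prices. *)
Let M1c := Defs.M1 fc Lam e.

Let M1cE x y : D x -> D y -> M1 x y = M1c x y.
Proof.
move=> Dx Dy; rewrite /M1c /Defs.M1 /payoff_high /payoff_low /payoff_tie /m /=.
by rewrite !clamp_pricesE.
Qed.

Let mD : measurable D. Proof. exact: measurable_itv. Qed.

Let mM1c : measurable_fun [set: measurableTypeR R * measurableTypeR R]
  (fun p => M1c p.1 p.2).
Proof.
pose T : measurableType _ := (measurableTypeR R * measurableTypeR R)%type.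
have m1 : measurable_fun [set: T] (fun p : T => p.1 : R).
  exact: measurable_fst.
have m2 : measurable_fun [set: T] (fun p : T => p.2 : R).
  exact: measurable_snd.
have mfc : measurable_fun [set: R] fc.
  exact: (continuous_measurable_fun (@extension_continuous _ _ _ b_gt0 f_diff)).
have mf1 : measurable_fun [set: T] (fun p : T => fc p.1).
  exact: (measurableT_comp mfc m1).
have mf2 : measurable_fun [set: T] (fun p : T => fc p.2).
  exact: (measurableT_comp mfc m2).
have mc (k : R) : measurable_fun [set: T] (fun _ : T => k : R).
  exact: measurable_cst.
apply: measurable_fun_ifT; first exact: measurable_fun_ltr.
- apply: measurable_fun_ifT; first exact: measurable_fun_ltr.
    exact: measurable_funM.
  apply: measurable_fun_ifT; first exact: measurable_fun_ltr.
    apply: measurable_funM => //; apply: measurable_funB => //.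
    exact: measurable_funM.
  exact: mc.
- apply: measurable_fun_ifT; first exact: measurable_fun_eqr.
    apply: measurable_fun_ifT; first exact: measurable_fun_ltr.
      exact: measurable_funM.
    by apply: measurable_funM => //; exact: measurable_funM.
  apply: measurable_fun_ifT; first exact: measurable_fun_ltr.
    exact: measurable_funM.
  apply: measurable_fun_ifT; first exact: measurable_fun_ltr.
    exact: measurable_funM.
  apply: measurable_funM => //; apply: measurable_minr => //.
  exact: measurable_funM.
Qed.

(* The expected payoff of the price x against the distribution function G. *)
Let u x : R := (if r < f x then m f Lam e x else 0) * G x + e * x * (1 - G x).

Let mE x : m f Lam e x = e * g x.
Proof.
rewrite m_margin// -[in RHS](mul_rho e Lam_gt0) /g.
by field; rewrite gt_eqF.
Qed.

Let eLE : e * L = m f Lam e q.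
Proof. by rewrite mE. Qed.

Let u_in x : L <= x -> x <= q -> u x = e * L.
Proof.
move=> Lx xq; have [Dx x0 rx xr] := itvP Lx xq.
rewrite /u rx mE G_id// /F; have := g_lt Lx xq => gx.
by field; rewrite subr_eq0 gt_eqF.
Qed.

Let u_le x : D x -> u x <= e * L.
Proof.
move=> Dx; have /pricesP[x0 xb] := Dx; have e0 := ltW e_gt0.
have [xL|/ltW Lx] := leP x L.
  by rewrite /u G_le// mulr0 add0r subr0 mulr1 ler_pM2l.
have [xq|/ltW qx] := leP x q; first by rewrite u_in.
rewrite /u G_ge// mulr1 subrr mulr0 addr0.
case: ifP => _; last by rewrite mulr_ge0// ltW.
by rewrite mE ler_pM2l// ler_pM2r ?invr_gt0//; exact: hq.
Qed.

Lemma mixed_equilibrium : exists sigma : probability (measurableTypeR R) R,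
  [/\ mixed_nash D M1 M2 sigma sigma,
      supported_over sigma `[h q / r, q] &
      forall x, h q / r <= x -> x <= q ->
        sigma `[h q / r, x]%classic = ((e * (x + q) - Lam * f q * q)
          / (2 * e * x - Lam * f x * x))%:E].
Proof.
rewrite -/L.
have [s sG] := probability_of_cdf G_nd G_cont G_le G_ge.
have sA : s `[L, q]%classic = 1%E.
  rewrite (cdf_itv_cc G_cont sG (ltW L_lt)).
  by rewrite (G_le (lexx L)) (G_ge (lexx q)) subr0.
have mA : measurable (`[L, q]%classic : set R) by exact: measurable_itv.
have AD : `[L, q]%classic `<=` D.
  by move=> x /=; rewrite in_itv/= => /andP[Lx xq]; have [] := itvP Lx xq.
have sD : mixed_strategy D s.
  apply/eqP; rewrite eq_le probability_le1//= -[in leLHS]sA.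
  by apply: le_measure; rewrite ?inE.
have m1 := measurable_section mM1c M1cE.
have M10 := M1_ge0 f_range Lam_gt0 e_gt0.
(* The opponent's y lies in [L, q], so rho < f(y) < 2 rho: against y < x the price x earns m(x) or
   0, against y > x it earns e x. *)
have inner x : D x -> (\int[s]_(y in D) (M1 x y)%:E = (u x)%:E)%E.
  move=> Dx; have /pricesP[x0 xb] := Dx.
  have e0 := ltW e_gt0.
  apply: (integral_step G_cont sG mD mA sA AD (m1 _ Dx)) => [y Dy|||y|y].
  - by rewrite lee_fin M10.
  - case: ifP => // rx; rewrite mE mulr_ge0// divr_ge0 ?(ltW r_gt0)//.
    by rewrite mulr_ge0// subr_ge0 ltW.
  - exact: mulr_ge0.
  - rewrite /= in_itv/= => /andP[Ly yq] yx; have [Dy y0 ry yr] := itvP Ly yq.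
    rewrite M1_high// /payoff_high ltNge.
    by have -> : f x <= 2 * r by apply: (le_trans _ (ltW yr)); exact/ltW/f_decr.
  - rewrite /= in_itv/= => /andP[Ly yq] xy; have [Dy y0 ry yr] := itvP Ly yq.
    by rewrite M1_low// /payoff_low ry if_same.
have EE t : expected_payoff D M1 t s =
    (\int[t]_(x in D) (\int[s]_(y in D) (M1 x y)%:E))%E.
  exact: (expected_payoffE mD mM1c M1cE M10).
have mu := measurable_expected mD mM1c M1cE M10 s.
have u0 x : D x -> (0 <= \int[s]_(y in D) (M1 x y)%:E)%E.
  by move=> Dx; apply: integral_ge0 => y Dy; rewrite lee_fin M10.
have eL0 : (0 <= (e * L)%:E)%E by rewrite lee_fin mulr_ge0// ltW.
have le_t t : mixed_strategy D t -> (expected_payoff D M1 t s <= (e * L)%:E)%E.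
  move=> tD; rewrite EE -[leRHS]mule1 -tD -integral_cst//.
  apply: ge0_le_integral => // x Dx.
  by rewrite inner// lee_fin u_le.
(* On [L, q], which carries [s], the inner integral is the constant e L; the rest of [D] contributes
   a nonnegative amount. *)
have ge_s : ((e * L)%:E <= expected_payoff D M1 s s)%E.
  rewrite EE -[leLHS]mule1 -sA -integral_cst//.
  apply: (@le_trans _ _
    (\int[s]_(x in `[L, q]) (\int[s]_(y in D) (M1 x y)%:E))%E).
    apply: ge0_le_integral => //.
    - exact: measurable_funS mu.
    - move=> x Ax; rewrite inner; last exact: AD.
      by move: Ax; rewrite /= in_itv/= => /andP[Lx xq]; rewrite u_in.
  exact: ge0_subset_integral.
have M2swap : M2 = fun x y => M1 y x.
  by apply/funext => x; apply/funext => y; rewrite M2E.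
have swap := expected_payoff_swap mD mM1c M1cE M10.
exists s; split.
- split => // t tD; first exact: le_trans (le_t t tD) ge_s.
  by rewrite M2swap !swap; exact: le_trans (le_t t tD) ge_s.
- apply: (cdf_supported G_cont sG L_lt (G_le (lexx L)) (G_ge (lexx q))) => x y.
  rewrite !in_itv/= => /andP[Lx xq] /andP[Ly yq] xy.
  by rewrite !G_id//; exact: F_incr.
- move=> x Lx xq.
  rewrite (cdf_itv_cc G_cont sG Lx) G_id// (G_le (lexx L)) subr0.
  have [Dx x0 rx xr] := itvP Lx xq; have gx := g_lt Lx xq.
  (* The left side is e x - m(q), and m(q) = e L. *)
  have -> : e * (x + q) - Lam * f q * q = e * (x - L).
    by rewrite mulrBr eLE /m; ring.
  have -> : 2 * e * x - Lam * f x * x = e * (x - g x).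
    by rewrite mulrBr -mE /m; ring.
  by congr (_%:E); rewrite /F; field; rewrite !gt_eqF// ?subr_gt0.
Qed.

End MixedEquilibrium.

(** Now f <= 1 <= rho everywhere, so a higher price earns 0 and a lower price y earns at most Lam
    f(y) y < eps. *)
Lemma eps_nash_small delta eps : 1 <= r -> 0 < delta -> delta <= b ->
  (forall x, 0 <= x -> x <= delta -> Lam * f x * x < eps) ->
  eps_nash D M1 M2 eps delta delta.
Proof.
move=> r1 d0 db small.
have Dd : D delta by apply/pricesP; split => //; exact: ltW.
have f1 x : D x -> f x <= r by move=> /f_range[_ /le_trans]; exact.
have f2 x : D x -> (2 * r < f x) = false.
  by move=> /f1 fr; apply/negbTE; rewrite -leNgt; lra.
have H y : D y -> M1 y delta <= M1 delta delta + eps.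
  move=> Dy; have /pricesP[y0 yb] := Dy; have [fd0 _] := f_range Dd.
  have eps0 : 0 < eps.
    by apply: le_lt_trans (small _ (ltW d0) (lexx _)); rewrite !mulr_ge0// ltW.
  have tie0 : 0 <= M1 delta delta by apply: (M1_ge0 f_range).
  have [yd|dy|->] := ltgtP y delta.
  - rewrite M1_low// /payoff_low f2// ltNge f1//=.
    have := small y y0 (ltW yd).
    have : Num.min e (Lam * f y) * y <= Lam * f y * y.
      by rewrite ler_wpM2r// ge_min lexx orbT.
    lra.
  - by rewrite M1_high// /payoff_high f2// ltNge f1//=; lra.
  - lra.
by split => // y Dy; rewrite !M2E H.
Qed.

End MixedEquilibria.

(** * Assembly of the three regimes *)

Theorem theorem3 (R : realType) (phi_h : R) (f : R -> R) (Lam e : R)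
  (phi_h_gt0 : 0 < phi_h)
  (f_concave : strictly_concave_on (prices phi_h) f)
  (f_decr : strictly_decreasing_on (prices phi_h) f)
  (f_diff : differentiable_on (prices phi_h) f)
  (f_range : forall phi, prices phi_h phi -> 0 < f phi /\ f phi <= 1)
  (f_0 : f 0 = 1)
  (Lam_gt0 : 0 < Lam) (e_gt0 : 0 < e) :
  let D := prices phi_h in
  let rho := rho Lam e in
  let M1 := M1 f Lam e in
  let M2 := M2 f Lam e in
  exists phi_b : R,
    is_max_of [set phi | D phi /\ 0 <= d_b phi_h f phi] phi_b /\
    [/\ (* (1) *)
        rho <= f phi_b / 2 ->
          unique (fun phi => pure_nash D M1 M2 phi phi)
                 (f_inv phi_h f (2 * rho)),
        (* (2) *)
        f phi_b / 2 < rho -> rho < 1 ->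
          (~ exists phi, pure_nash D M1 M2 phi phi) /\
          exists (phi_L phi_R : R) (sigma : probability (measurableTypeR R) R),
            [/\ unique (is_maximizer D (fun phi => (f phi - rho) * phi / rho))
                       phi_R,
                phi_L = (f phi_R - rho) * phi_R / rho,
                mixed_nash D M1 M2 sigma sigma,
                supported_over sigma `[phi_L, phi_R] &
                forall phi, phi_L <= phi -> phi <= phi_R ->
                  sigma `[phi_L, phi]%classic =
                    ((e * (phi + phi_R) - Lam * f phi_R * phi_R)
                     / (2 * e * phi - Lam * f phi * phi))%:E] &
        (* (3) *)
        1 <= rho -> forall eps : R, 0 < eps ->
          let admissible (delta : R) :=
            [/\ 0 < delta, delta <= phi_h &
                sup [set Lam * f phi * phi | phi in `[0, delta]] < eps] in
          (exists delta, admissible delta) /\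
          forall delta, admissible delta ->
            eps_nash D M1 M2 eps delta delta].
Proof.
move=> D rho0 N1 N2.
have [p p_max] := exists_phi_b phi_h_gt0 f_concave f_diff f_0.
exists p; split => //; split.
- exact: pure_nash_threshold.
- move=> pr r1; split; first exact: no_pure_nash pr r1.
  have r0 : 0 < rho0 := rho_gt0 Lam_gt0 e_gt0.
  have [q Dq hq] := margin_argmax phi_h_gt0 f_diff rho0.
  have [q0 rq qr] := argmax_between phi_h_gt0 f_concave f_decr f_diff f_0
    Lam_gt0 e_gt0 p_max pr r1 Dq hq.
  have [s [sN sS sF]] := mixed_equilibrium phi_h_gt0 f_concave f_decr f_diff
    f_range Lam_gt0 e_gt0 Dq hq q0 rq qr.
  exists ((f q - rho0) * q / rho0), q, s; split => //.
  split; first by split => // y Dy; rewrite ler_pM2r ?invr_gt0//; exact: hq.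
  move=> z [Dz hz]; apply: (margin_argmax_unique f_concave f_decr Dq hq Dz).
  by move=> y /hz; rewrite ler_pM2r// invr_gt0.
- move=> r1 eps eps0 admissible.
  have fL x : D x -> Lam * f x * x <= Lam * x.
    move=> Dx; have /pricesP[x0 _] := Dx; have [_ f1] := f_range _ Dx.
    by rewrite ler_wpM2r// ler_piMr// ltW.
  split.
    (* Since f <= 1, Lam f(x) x <= Lam d <= eps / 2 on [0, d], and the supremum stays strictly below
       eps. *)
    pose d := Num.min phi_h (eps / (2 * Lam)).
    have d0 : 0 < d by rewrite lt_min phi_h_gt0 divr_gt0// mulr_gt0.
    have db : d <= phi_h by rewrite ge_min lexx.
    exists d; split => //.
    apply: (@le_lt_trans _ _ (eps / 2)); last by lra.
    apply: ge_sup.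
      by exists (Lam * f 0 * 0); exists 0 => //=; rewrite in_itv/= lexx ltW.
    move=> _ [x /= + <-]; rewrite in_itv/= => /andP[x0 xd].
    have Dx : D x by apply/pricesP; split => //; exact: le_trans db.
    apply: (le_trans (fL _ Dx)); rewrite -ler_pdivlMl//.
    apply: (le_trans xd); rewrite ge_min; apply/orP; right.
    by rewrite le_eqVlt; apply/orP; left; apply/eqP; field; rewrite gt_eqF.
  move=> delta [d0 db sd]; apply: eps_nash_small => // x x0 xd.
  apply: le_lt_trans sd; apply: ub_le_sup.
    (* The set is bounded above, so its [sup] really dominates each value. *)
    exists (Lam * phi_h) => _ [y /= + <-]; rewrite in_itv/= => /andP[y0 yd].
    have yb := le_trans yd db.
    by apply: (le_trans (fL _ _)); [exact/pricesP|rewrite ler_pM2l].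
  by exists x => //=; rewrite in_itv/= x0.
Qed.
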